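(* Let $G$ be a $d$-$(u,v)$-universally diametrical graph of order $n$ such that $2d^2+9d+6\geq n$. Let $G^*$ be the graph obtained from $G$ by attaching a new pendant vertex $u'$ to $u$ and a new pendant vertex $v'$ to $v$. If $E_1(G)>W(G)$, then $E_1(G^* )>W(G^* )$.
   Context: All graphs are finite, simple, connected. $\varepsilon_G(w)=\max_x d_G(w,x)$ is the eccentricity, ${\rm diam}(G)=\max_w\varepsilon_G(w)$, and ${\rm Ecc}_G(w)=\{x: d_G(w,x)=\varepsilon_G(w)\}$ is the eccentric set of $w$. Vertices $u,v$ are diametrical if $d_G(u,v)={\rm diam}(G)$. $G$ is universally diametrical with universally diametrical pair $u,v$ if $u,v$ are diametrical vertices and ${\rm Ecc}_G(w)\cap\{u,v\}\neq\emptyset$ for every $w\in V(G)\setminus\{u,v\}$; it is $d$-$(u,v)$-universally diametrical if in addition $d_G(u,v)={\rm diam}(G)=d$. $E_1(G)=\sum_w\varepsilon_G(w)^2$ and $W(G)=\sum_{\{x,y\}\subseteq V(G)}d_G(x,y)$ is the Wiener index. *)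

(* Defs.v *)
From mathcomp Require Import all_boot.

Set Implicit Arguments.
Unset Strict Implicit.
Unset Printing Implicit Defensive.

(* A finite simple graph is given by its adjacency relation [e : rel T] on a
   finite type [T] of vertices, assumed [symmetric] and [irreflexive]. *)

Definition connected (T : finType) (e : rel T) : Prop :=
  forall x y : T, connect e x y.

Definition has_walk (T : finType) (e : rel T) (x y : T) (k : nat) : bool :=
  [exists p : k.-tuple T, path e x p && (last x p == y)].

(* The least length of a walk from [x] to [y].  Shortest walks have length
   less than [#|T|], so a bounded search suffices; the value is [#|T|] when
   [y] is not reachable from [x], which does not occur in connected graphs. *)
Definition dist (T : finType) (e : rel T) (x y : T) : nat :=
  find (has_walk e x y) (iota 0 #|T|).

Definition ecc (T : finType) (e : rel T) (w : T) : nat :=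
  \max_(x : T) dist e w x.

Definition diam (T : finType) (e : rel T) : nat := \max_(w : T) ecc e w.

Definition ecc_set (T : finType) (e : rel T) (w : T) : {set T} :=
  [set x | dist e w x == ecc e w].

Definition diametrical (T : finType) (e : rel T) (u v : T) : Prop :=
  dist e u v = diam e.

Definition universally_diametrical_pair (T : finType) (e : rel T) (u v : T) :
    Prop :=
  diametrical e u v /\
  forall w : T, w \notin [set u; v] -> ecc_set e w :&: [set u; v] != set0.

Definition d_universally_diametrical (T : finType) (e : rel T) (d : nat)
    (u v : T) : Prop :=
  universally_diametrical_pair e u v /\ dist e u v = d.

Definition E1 (T : finType) (e : rel T) : nat := \sum_(w : T) ecc e w ^ 2.

(* Each unordered pair of distinct vertices is counted once, represented by the
   ordered pair that is increasing for the enumeration of [T]. *)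
Definition wiener (T : finType) (e : rel T) : nat :=
  \sum_(p : T * T | enum_rank p.1 < enum_rank p.2) dist e p.1 p.2.

(* The new vertex [inr false] is adjacent to [inl u] only, and the new vertex
   [inr true] to [inl v] only. *)
Definition attach_pendants (T : finType) (e : rel T) (u v : T) :
    rel (T + bool) :=
  fun a b =>
    match a, b with
    | inl x, inl y => e x y
    | inl x, inr c | inr c, inl x => x == (if c then v else u)
    | inr _, inr _ => false
    end.

(* Main.v *)
Require Import Defs.
From mathcomp Require Import all_boot zify.

(* Attaching the pendants raises every eccentricity of [G] by at least one and
   gives both new vertices eccentricity at least [d + 2], so [E1] grows by at
   least [2 * \sum_w ecc w + n + 2 * (d + 2) ^ 2], while the Wiener index grows
   by exactly [\sum_w (dist w u + dist w v) + 2 * n + d + 2].  Bounding each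
   [dist w u + dist w v] by [2 * ecc w], with slack [d] at [w = u] and again at
   [w = v], the first increment dominates the second as soon as
   [n <= 2 * d ^ 2 + 9 * d + 6]. *)

Set Implicit Arguments.
Unset Strict Implicit.
Unset Printing Implicit Defensive.

Section Distance.

Variables (T : finType) (e : rel T).

Lemma dist_le_card x y : dist e x y <= #|T|.
Proof. by rewrite /dist -[leqRHS](size_iota 0); apply: find_size. Qed.

Lemma dist_path_le x p : path e x p -> dist e x (last x p) <= size p.
Proof.
move=> xp; have [lt_pT|] := ltnP (size p) #|T|; last first.
  exact/leq_trans/dist_le_card.
rewrite leqNgt; apply/negP=> /(before_find 0).
rewrite nth_iota // add0n => /negbT/existsPn/(_ (in_tuple p)).
by rewrite /= xp eqxx.
Qed.

Lemma dist_pathP x y : dist e x y < #|T| ->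
  exists p, [/\ path e x p, last x p = y & size p = dist e x y].
Proof.
move=> lt_dT; have: has (has_walk e x y) (iota 0 #|T|).
  by rewrite has_find size_iota.
move=> /(nth_find 0); rewrite nth_iota // => /existsP[p /andP[xp /eqP yp]].
by exists p; rewrite size_tuple.
Qed.

Lemma dist_lt_card x y : connect e x y -> dist e x y < #|T|.
Proof.
move=> /connectP[p xp ->]; case/shortenP: xp => q xq uq _.
by apply: leq_ltn_trans (dist_path_le xq) _; rewrite -[_.+1](card_uniqP uq) max_card.
Qed.

Lemma dist_refl x : dist e x x = 0.
Proof. by apply/eqP; rewrite -leqn0 (@dist_path_le x [::]). Qed.

Lemma dist_edge x y : e x y -> dist e x y <= 1.
Proof. by move=> xy; rewrite (@dist_path_le x [:: y]) //= xy. Qed.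

(** If a summand takes the default value [#|T|], it alone bounds the left side; otherwise shortest
    walks concatenate. *)
Lemma dist_triangle y x z : dist e x z <= dist e x y + dist e y z.
Proof.
have := dist_le_card x z.
have [/dist_pathP[p [xp <- <-]]|] := ltnP (dist e x y) #|T|; last by lia.
have [/dist_pathP[q [pq <- <-]] _|] := ltnP (dist e (last x p) z) #|T|.
  by rewrite -last_cat -size_cat dist_path_le // cat_path xp.
by lia.
Qed.

Lemma dist_sym : symmetric e -> forall x y, dist e x y = dist e y x.
Proof.
move=> e_sym; suff le x y : dist e x y <= dist e y x.
  by move=> x y; apply/eqP; rewrite eqn_leq !le.
have [/dist_pathP[p [yp <- <-]]|] := ltnP (dist e y x) #|T|; last first.
  exact/leq_trans/dist_le_card.
have: path e (last y p) (rev (belast y p)).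
  by rewrite rev_path -(eq_path (e := e)) // => a b; apply: e_sym.
move=> /dist_path_le; rewrite size_rev size_belast.
by case: p yp => //= z p _; rewrite rev_cons last_rcons.
Qed.

(** The tool for lower bounds on distances: a potential that rises by at most one along each edge
    certifies them. *)
Lemma lipschitz_le_dist (f : T -> nat) x y : dist e x y < #|T| ->
  (forall a b, e a b -> f b <= (f a).+1) -> f y <= f x + dist e x y.
Proof.
move=> /dist_pathP[p [xp <- <-]] f_lip.
elim: p x xp => [|z p IHp] x /=; first by rewrite addn0.
move=> /andP[/f_lip fxz /IHp]; lia.
Qed.

Lemma dist_le_ecc x y : dist e x y <= ecc e x.
Proof. exact: (leq_bigmax (F := dist e x)). Qed.

Lemma ecc_le_diam x : ecc e x <= diam e.
Proof. exact: (leq_bigmax (F := ecc e)). Qed.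

(** Swapping coordinates matches the increasing pairs with the decreasing ones, and the diagonal
    contributes nothing. *)
Lemma double_wiener : symmetric e ->
  2 * wiener e = \sum_x \sum_y dist e x y.
Proof.
move=> e_sym; rewrite pair_bigA /=.
rewrite (bigID (fun p => enum_rank p.1 < enum_rank p.2)) /= mul2n -addnn.
congr (_ + _).
rewrite [RHS](bigID (fun p => p.1 == p.2)) /= big1 ?add0n => [|[x y] /=]; last first.
  by case/andP=> _ /eqP->; rewrite dist_refl.
rewrite /wiener (reindex_inj (h := fun p : T * T => (p.2, p.1))) /=; last first.
  by move=> [a b] [a' b'] [-> ->].
apply: eq_big => [[x y] | [x y] _] /=; last exact: dist_sym.
rewrite -leqNgt ltn_neqAle andbC (inj_eq val_inj) (inj_eq enum_rank_inj).
by rewrite eq_sym.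
Qed.

End Distance.

Section AttachPendants.

Variables (T : finType) (e : rel T) (u v : T).
Hypotheses (e_sym : symmetric e) (e_conn : connected e).

Let e' := attach_pendants e u v.

Definition foot (a : T + bool) : T :=
  match a with inl x => x | inr c => if c then v else u end.

Definition height (a : T + bool) : nat :=
  if a is inr _ then 1 else 0.

Lemma attach_pendants_sym : symmetric e'.
Proof. by move=> [x|c] [y|c'] //=. Qed.

(** Go down to the foot of [a], across [G], then up to [b]. The bound is strict when [a] and [b] are
    the same pendant. *)
Lemma dist_attach_le a b :
  dist e' a b <= dist e (foot a) (foot b) + height a + height b.
Proof.
have to_foot c : dist e' c (inl (foot c)) <= height c.
  case: c => [x|c] /=; first by rewrite dist_refl.
  by apply: dist_edge => /=.
have inl_le x y : dist e' (inl x) (inl y) <= dist e x y.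
  have /dist_pathP[p [xp <- <-]] := dist_lt_card (e_conn x y).
  have := @dist_path_le _ e' (inl x) (map inl p).
  by rewrite path_map last_map size_map; apply.
have := dist_triangle e' (inl (foot a)) a b.
have := dist_triangle e' (inl (foot b)) (inl (foot a)) b.
have := inl_le (foot a) (foot b).
rewrite (dist_sym attach_pendants_sym (inl (foot b))).
by move: (to_foot a) (to_foot b); lia.
Qed.

Lemma dist_attach a b : a != b ->
  dist e' a b = dist e (foot a) (foot b) + height a + height b.
Proof.
move=> neq_ab; apply/eqP; rewrite eqn_leq dist_attach_le /=.
(* The potential is the claimed distance from [a], reset to 0 at [a], where the formula would give 2
   for a pendant. *)
pose f c := if a == c then 0 else dist e (foot a) (foot c) + height a + height c.
have -> : dist e (foot a) (foot b) + height a + height b = f b.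
  by rewrite /f (negPf neq_ab).
have -> : dist e' a b = f a + dist e' a b by rewrite /f eqxx.
apply: lipschitz_le_dist => [|b1 b2 b12].
  (* The distance between the feet is at most [#|T| - 1] and the heights add at most 2, which stays
     below [#|T| + 2]. *)
  have := dist_attach_le a b; have := dist_lt_card (e_conn (foot a) (foot b)).
  rewrite card_sum card_bool; have : height a <= 1 by case: (a).
  have : height b <= 1 by case: (b).
  by lia.
(* The first bound serves edges away from [a], via the triangle inequality; the second serves edges
   leaving [a], where [f] starts from 0. *)
have foot_le : dist e (foot b1) (foot b2) + height b2 <= (height b1).+1
             /\ dist e (foot b1) (foot b2) + height b1 + height b2 <= 1.
  case: b1 b2 b12 => [x|c] [y|c'] //=; first by move=> /dist_edge; lia.
    by move=> /eqP->; rewrite dist_refl.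
  by move=> /eqP->; rewrite dist_refl.
rewrite /f; case: eqP => [//|_]; case: eqP => [->|_]; first by lia.
by have := dist_triangle e (foot b1) (foot a) (foot b2); lia.
Qed.

(** Doubling reduces this to row sums of the distance matrix: old distances persist, and each
    pendant contributes the row of its foot raised by one, plus the distance between the two
    pendants. *)
Lemma wiener_attach :
  wiener e' = wiener e + \sum_x (dist e x u + dist e x v) + 2 * #|T|
              + dist e u v + 2.
Proof.
apply/eqP; rewrite -(eqn_pmul2l (m := 2)) // double_wiener; last first.
  exact: attach_pendants_sym.
rewrite !mulnDr double_wiener // big_sumType /=.
have row x : \sum_b dist e' (inl x) b
    = \sum_y dist e x y + (dist e x u + dist e x v + 2).
  rewrite big_sumType big_bool /= !dist_attach //= !addn0.
  congr (_ + _); last by lia.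
  apply: eq_bigr => y _; have [->|neq_xy] := eqVneq x y; first by rewrite !dist_refl.
  by rewrite dist_attach //= !addn0.
rewrite (eq_bigr _ (fun x _ => row x)) !big_split /= sum_nat_const.
rewrite (eq_card (B := T)) //.
rewrite big_bool !big_sumType !big_bool /= !dist_refl.
have pend c : \sum_x dist e' (inr c) (inl x)
    = \sum_x dist e x (if c then v else u) + #|T|.
  rewrite -sum1_card -big_split; apply: eq_bigr => x _ /=.
  by rewrite dist_attach //= addn0 (dist_sym e_sym).
rewrite !pend !dist_attach //= (dist_sym e_sym v u).
by apply/eqP; lia.
Qed.

End AttachPendants.

Theorem theorem4p2 (T : finType) (e : rel T) (e_sym : symmetric e)
    (e_irr : irreflexive e) (e_conn : connected e) (n d : nat) (u v : T)
    (order_n : #|T| = n)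
    (G_ud : d_universally_diametrical e d u v)
    (n_le : 2 * d ^ 2 + 9 * d + 6 >= n)
    (E1_gt_W : E1 e > wiener e) :
  E1 (attach_pendants e u v) > wiener (attach_pendants e u v).
Proof.
case: G_ud => [[diam_uv ud] dist_uv].
have ecc_le_d w : ecc e w <= d by rewrite -dist_uv diam_uv ecc_le_diam.
have ecc_u : ecc e u = d.
  by apply/eqP; rewrite eqn_leq ecc_le_d -dist_uv dist_le_ecc.
have ecc_v : ecc e v = d.
  by apply/eqP; rewrite eqn_leq ecc_le_d -dist_uv dist_sym // dist_le_ecc.
(* The hypothesis [ud] covers only the other vertices; [u] and [v] are farthest from each other
   because they are diametrical. *)
have ecc_uv w : ecc e w = dist e w u \/ ecc e w = dist e w v.
  have [->|neq_wu] := eqVneq w u; first by right; rewrite ecc_u.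
  have [->|neq_wv] := eqVneq w v; first by left; rewrite ecc_v dist_sym.
  have /ud/set0Pn[x] : w \notin [set u; v] by rewrite !inE negb_or neq_wu.
  by rewrite !inE => /andP[/eqP<- /orP[]/eqP->]; [left | right].
(* The pendant at whichever of [u], [v] is farthest from [w] lies one step farther still. *)
have ecc_inl w : (ecc e w).+1 <= ecc (attach_pendants e u v) (inl w).
  have := dist_le_ecc (attach_pendants e u v) (inl w) (inr false).
  have := dist_le_ecc (attach_pendants e u v) (inl w) (inr true).
  rewrite !dist_attach //= !addn0 !addn1.
  by case: (ecc_uv w) => ->.
have ecc_inr c : d + 2 <= ecc (attach_pendants e u v) (inr c).
  have := dist_le_ecc (attach_pendants e u v) (inr c) (inr (~~ c)).
  rewrite dist_attach //=; last by case: c.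
  by case: c => /=; rewrite ?(dist_sym e_sym v u) dist_uv; lia.
have sum_dist_le : \sum_x (dist e x u + dist e x v) + 2 * d <= 2 * \sum_x ecc e x.
  have sum_at (w : T) : \sum_x (x == w) * d = d.
    rewrite (bigD1 w) //= eqxx mul1n big1 ?addn0 // => x /negPf->.
    by rewrite mul0n.
  (* Writing the slack as indicator terms allows a termwise comparison: at [x = u] the summand
     [dist e x u] vanishes while [ecc e u = d], and likewise at [v]. *)
  have -> : 2 * d = \sum_x ((x == u) * d + (x == v) * d).
    by rewrite big_split /= !sum_at; lia.
  rewrite -big_split big_distrr /=.
  apply: leq_sum => x _; have := dist_le_ecc e x u; have := dist_le_ecc e x v.
  have [->|_] := eqVneq x u; have [->|_] := eqVneq _ v;
    rewrite ?dist_refl ?ecc_u ?ecc_v; lia.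
have E1_ge : E1 e + 2 * \sum_x ecc e x + #|T| + 2 * (d + 2) ^ 2
    <= E1 (attach_pendants e u v).
  rewrite [leqRHS]/E1 big_sumType big_bool /= [2 * (_ ^ 2)]mul2n -addnn.
  apply: leq_add; last by apply: leq_add; rewrite leq_exp2r.
  rewrite /E1 -sum1_card big_distrr -!big_split; apply: leq_sum => x _ /=.
  apply: (@leq_trans ((ecc e x + 1) ^ 2)); first by rewrite sqrnD; lia.
  by rewrite leq_exp2r // addn1.
(* After cancelling the eccentricity sums, the surplus is at least [(E1 e - wiener e) + (2 * d ^ 2 +
   9 * d + 6 - n)], since [2 * (d + 2) ^ 2 + 2 * d - (d + 2) = 2 * d ^ 2 + 9 * d + 6]. *)
by move: E1_ge; rewrite wiener_attach // dist_uv sqrnD order_n; lia.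
Qed.
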